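(* For a two-player stage game $G$, we have $G\notin\mathcal{G}_{LS}^{p,p}$ and $G\in\mathcal{G}_{LS}^{m,m}$ if and only if one of the following holds: (1) $|V_1^{p,p}|=0$, $|V_2^{p,p}|=0$, and $\mathcal{C}^{m,m}(G)$ holds; (2) $|V_1^{p,p}|=1$, $|V_2^{p,p}|=1$, and $\mathcal{C}^{m,m}(G)$ holds; (3) $|V_1^{p,p}|>1$, $|V_2^{p,p}|=1$, $\mathcal{C}^{p,p}(G)$ does not hold, and $\mathcal{C}^{m,m}(G)$ holds; (4) $|V_1^{p,p}|=1$, $|V_2^{p,p}|>1$, $\mathcal{C}^{p,p}(G)$ does not hold, and $\mathcal{C}^{m,m}(G)$ holds.
   Context: A two-player stage game $G$ has finite nonempty action sets $A_1,A_2$ and payoffs $u_1,u_2:A_1\times A_2\to\mathbb{R}$, extended to mixed strategies by expectation; best response means maximizing expected payoff against the opponent's strategy. $G(T)$ is the $T$-round repetition with realized actions observed each round and payoffs the expected sum of stage payoffs; an SPE of $G(T)$ is a strategy profile whose continuation after every history of length $k<T$ is a Nash equilibrium of $G(T-k)$. Regimes: pure-pure ($p,p$): both players restricted to actions (in the stage game and in every round, including deviations); mixed-pure ($m,p$): player 1 may mix, player 2 uses only actions; mixed-mixed ($m,m$): both may mix. For regime $r$, $\mathrm{Nash}^r(G)$ is the set of stage-game profiles available in $r$ from which no player can profitably deviate unilaterally to a strategy available in $r$, and $V_i^r=\{u_i(\sigma):\sigma\in\mathrm{Nash}^r(G)\}$. Locally suboptimal behavior occurs in an SPE $\mu$ of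 $G(T)$ (regime $r$) if for some history $h$ of length $k<T$, $(\mu_1(h),\mu_2(h))\notin\mathrm{Nash}^r(G)$. $\mathcal{G}_{LS}^r$ is the set of stage games $G$ for which there exist $T\ge1$ and an SPE of $G(T)$ in regime $r$ in which locally suboptimal behavior occurs. Condition $\mathcal{C}^{p,p}(G)$ holds iff one of: (i) $|V_1^{p,p}|>1$, $|V_2^{p,p}|>1$, and some $(\hat a_1,\hat a_2)\in A_1\times A_2$ is not in $\mathrm{Nash}^{p,p}(G)$; (ii) $|V_1^{p,p}|>1$, $|V_2^{p,p}|=1$, and there exist $\hat a_1,a_1'\in A_1$, $\hat a_2\in A_2$ with $u_1(\hat a_1,\hat a_2)<u_1(a_1',\hat a_2)$ and $\hat a_2$ a best response to $\hat a_1$; (iii) $|V_1^{p,p}|=1$, $|V_2^{p,p}|>1$, and there exist $\hat a_1\in A_1$, $\hat a_2,a_2'\in A_2$ with $u_2(\hat a_1,\hat a_2)<u_2(\hat a_1,a_2')$ and $\hat a_1$ a best response to $\hat a_2$. Condition $\mathcal{C}^{m,m}(G)$ holds iff one of: (i) $|V_1^{m,m}|>1$, $|V_2^{m,m}|>1$, and some $(\hat\sigma_1,\hat\sigma_2)\in\Delta A_1\times\Delta A_2$ is not in $\mathrm{Nash}^{m,m}(G)$; (ii) $|V_1^{m,m}|>1$, $|V_2^{m,m}|=1$, and there exist $\hat\sigma_1,\hat\sigma_2$, $a_1'\in A_1$ with $u_1(\hat\sigma_1,\hat\sigma_2)<u_1(a_1',\hat\sigma_2)$ and $\hat\sigma_2$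 a best response to $\hat\sigma_1$; (iii) $|V_1^{m,m}|=1$, $|V_2^{m,m}|>1$, and there exist $\hat\sigma_1,\hat\sigma_2$, $a_2'\in A_2$ with $u_2(\hat\sigma_1,\hat\sigma_2)<u_2(\hat\sigma_1,a_2')$ and $\hat\sigma_1$ a best response to $\hat\sigma_2$. *)

(* Defs.v *)
From mathcomp Require Import all_boot all_order all_algebra.
From mathcomp Require Import reals.
Set Implicit Arguments. Unset Strict Implicit. Unset Printing Implicit Defensive.
Import Order.TTheory GRing.Theory Num.Theory.
Local Open Scope ring_scope.

Section Game.
Variable R : realType.
Variables A1 A2 : finType.
Variables u1 u2 : A1 -> A2 -> R.

Definition is_dist (A : finType) (p : {ffun A -> R}) : Prop :=
  (forall a, 0 <= p a) /\ \sum_(a : A) p a = 1.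

Definition dirac (A : finType) (a : A) : {ffun A -> R} :=
  [ffun b => (b == a)%:R].

Definition exp_payoff (u : A1 -> A2 -> R)
    (s1 : {ffun A1 -> R}) (s2 : {ffun A2 -> R}) : R :=
  \sum_(a1 : A1) \sum_(a2 : A2) s1 a1 * s2 a2 * u a1 a2.

Definition hist := seq (A1 * A2).

Fixpoint cont_payoff (u : A1 -> A2 -> R) (s1 : hist -> {ffun A1 -> R})
    (s2 : hist -> {ffun A2 -> R}) (n : nat) (h : hist) : R :=
  match n with
  | 0 => 0
  | n'.+1 => \sum_(a1 : A1) \sum_(a2 : A2)
        s1 h a1 * s2 h a2 * (u a1 a2 + cont_payoff u s1 s2 n' (rcons h (a1, a2)))
  end.

Definition liftp (A : finType) (m : hist -> A) : hist -> {ffun A -> R} :=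
  fun h => dirac (m h).

Definition is_behav (A : finType) (s : hist -> {ffun A -> R}) : Prop :=
  forall h, is_dist (s h).

Definition NashPP (a1 : A1) (a2 : A2) : Prop :=
  (forall b1 : A1, u1 b1 a2 <= u1 a1 a2) /\ (forall b2 : A2, u2 a1 b2 <= u2 a1 a2).

Definition NashMM (s1 : {ffun A1 -> R}) (s2 : {ffun A2 -> R}) : Prop :=
  [/\ is_dist s1, is_dist s2,
      (forall t1, is_dist t1 -> exp_payoff u1 t1 s2 <= exp_payoff u1 s1 s2)
    & (forall t2, is_dist t2 -> exp_payoff u2 s1 t2 <= exp_payoff u2 s1 s2)].

Definition V1pp (v : R) : Prop := exists a1 a2, NashPP a1 a2 /\ v = u1 a1 a2.
Definition V2pp (v : R) : Prop := exists a1 a2, NashPP a1 a2 /\ v = u2 a1 a2.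
Definition V1mm (v : R) : Prop :=
  exists s1 s2, NashMM s1 s2 /\ v = exp_payoff u1 s1 s2.
Definition V2mm (v : R) : Prop :=
  exists s1 s2, NashMM s1 s2 /\ v = exp_payoff u2 s1 s2.

Definition SPE_pp (T : nat) (m1 : hist -> A1) (m2 : hist -> A2) : Prop :=
  forall h : hist, (size h < T)%N ->
    (forall t1 : hist -> A1,
       cont_payoff u1 (liftp t1) (liftp m2) (T - size h) h
       <= cont_payoff u1 (liftp m1) (liftp m2) (T - size h) h) /\
    (forall t2 : hist -> A2,
       cont_payoff u2 (liftp m1) (liftp t2) (T - size h) h
       <= cont_payoff u2 (liftp m1) (liftp m2) (T - size h) h).

Definition SPE_mm (T : nat) (s1 : hist -> {ffun A1 -> R})
    (s2 : hist -> {ffun A2 -> R}) : Prop :=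
  [/\ is_behav s1, is_behav s2 &
  forall h : hist, (size h < T)%N ->
    (forall t1, is_behav t1 ->
       cont_payoff u1 t1 s2 (T - size h) h
       <= cont_payoff u1 s1 s2 (T - size h) h) /\
    (forall t2, is_behav t2 ->
       cont_payoff u2 s1 t2 (T - size h) h
       <= cont_payoff u2 s1 s2 (T - size h) h)].

Definition GLS_pp : Prop :=
  exists T : nat, (1 <= T)%N /\
    exists (m1 : hist -> A1) (m2 : hist -> A2), SPE_pp T m1 m2 /\
      exists h : hist, (size h < T)%N /\ ~ NashPP (m1 h) (m2 h).

Definition GLS_mm : Prop :=
  exists T : nat, (1 <= T)%N /\
    exists (s1 : hist -> {ffun A1 -> R}) (s2 : hist -> {ffun A2 -> R}),
      SPE_mm T s1 s2 /\
      exists h : hist, (size h < T)%N /\ ~ NashMM (s1 h) (s2 h).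

Definition card_is0 (V : R -> Prop) : Prop := forall v, ~ V v.
Definition card_is1 (V : R -> Prop) : Prop := exists v, forall w, V w <-> w = v.
Definition card_gt1 (V : R -> Prop) : Prop := exists v w, [/\ V v, V w & v <> w].

Definition C_pp : Prop :=
  [\/ [/\ card_gt1 V1pp, card_gt1 V2pp & exists a1 a2, ~ NashPP a1 a2],
      [/\ card_gt1 V1pp, card_is1 V2pp &
        exists (ha1 a1' : A1) (ha2 : A2),
          u1 ha1 ha2 < u1 a1' ha2 /\ (forall b2, u2 ha1 b2 <= u2 ha1 ha2)]
    | [/\ card_is1 V1pp, card_gt1 V2pp &
        exists (ha1 : A1) (ha2 a2' : A2),
          u2 ha1 ha2 < u2 ha1 a2' /\ (forall b1, u1 b1 ha2 <= u1 ha1 ha2)]].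

Definition C_mm : Prop :=
  [\/ [/\ card_gt1 V1mm, card_gt1 V2mm &
        exists s1 s2, [/\ is_dist s1, is_dist s2 & ~ NashMM s1 s2]],
      [/\ card_gt1 V1mm, card_is1 V2mm &
        exists s1 s2 (a1' : A1), [/\ is_dist s1, is_dist s2,
          exp_payoff u1 s1 s2 < exp_payoff u1 (dirac a1') s2 &
          forall t2, is_dist t2 -> exp_payoff u2 s1 t2 <= exp_payoff u2 s1 s2]]
    | [/\ card_is1 V1mm, card_gt1 V2mm &
        exists s1 s2 (a2' : A2), [/\ is_dist s1, is_dist s2,
          exp_payoff u2 s1 s2 < exp_payoff u2 s1 (dirac a2') &
          forall t1, is_dist t1 -> exp_payoff u1 t1 s2 <= exp_payoff u1 s1 s2]]].

End Game.

(* Main.v *)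
(** In both regimes locally suboptimal play is possible exactly under the incentive
    condition. Necessity: at the last suboptimal history the continuation is always
    stage Nash, so a player with a single Nash value best responds there. Sufficiency:
    play the required profile once and then reward or punish by long runs of stage
    Nash equilibria. In the mixed regime, if only player 1 has several Nash values,
    she must in addition be kept indifferent over the support of her first-round
    strategy. Either her Nash values contain an interval, and the continuation can
    compensate her exactly; or some pure profile can be used; or there are two
    actions a, d of player 1 without a common best response, and the intermediate
    value theorem on the edge ad yields a mixture of a and d with a best response
    making her exactly indifferent between them. Player 2 then gets less than his
    unique Nash value, so this profile is not Nash.
    Finally, if both players have several pure Nash values and [C_pp] fails, every
    pure, hence every mixed, profile is Nash, which contradicts [C_mm]. *)
Require Import Defs.
From mathcomp Require Import all_boot all_order all_algebra.
From mathcomp Require Import reals.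
From mathcomp Require Import boolp classical_sets topology.
From mathcomp Require Import pseudometric_normed_Zmodule normed_module.
From mathcomp Require Import ring lra zify.
Set Implicit Arguments. Unset Strict Implicit. Unset Printing Implicit Defensive.
Import Order.TTheory GRing.Theory Num.Theory numFieldNormedType.Exports.
Local Open Scope ring_scope.

(** * Expected payoffs *)

Section Distributions.
Context {R : realType} {A : finType}.
Implicit Types (p q : {ffun A -> R}) (f : A -> R) (c t : R).

Lemma sum_dirac a f : \sum_b dirac R a b * f b = f a.
Proof.
rewrite (bigD1 a) //= ffunE eqxx mul1r big1 ?addr0 // => b /negbTE ba.
by rewrite ffunE ba mul0r.
Qed.

Lemma is_dist_dirac (a : A) : is_dist (dirac R a).
Proof.
split=> [b|]; first by rewrite ffunE ler0n.
by rewrite -[RHS](sum_dirac a (fun=> 1)); apply: eq_bigr => b _; rewrite mulr1.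
Qed.

Lemma dist_sum_const p c : is_dist p -> \sum_a p a * c = c.
Proof. by case=> _ p1; rewrite -mulr_suml p1 mul1r. Qed.

Lemma dist_sum_le p f c : is_dist p -> (forall a, f a <= c) ->
  \sum_a p a * f a <= c.
Proof.
move=> dp fc; rewrite -[leRHS](dist_sum_const c dp).
by apply: ler_sum => a _; apply: ler_wpM2l => //; case: dp.
Qed.

Lemma dist_sum_eq p f c : is_dist p -> (forall a, p a != 0 -> f a = c) ->
  \sum_a p a * f a = c.
Proof.
move=> dp fc; rewrite -[RHS](dist_sum_const c dp); apply: eq_bigr => a _.
by have [->|/fc->] := eqVneq (p a) 0; rewrite ?mul0r.
Qed.

Lemma dist_sum_attained p f c : is_dist p -> (forall a, f a <= c) ->
  \sum_a p a * f a = c -> forall a, p a != 0 -> f a = c.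
Proof.
move=> dp fc /esym; rewrite -{1}(dist_sum_const c dp) => /eqP.
rewrite -subr_eq0 -sumrB psumr_eq0 => [/allP H a pa|a _]; last first.
  by rewrite -mulrBr mulr_ge0 ?subr_ge0 //; case: dp.
have /implyP/(_ isT) := H a (mem_index_enum a).
by rewrite -mulrBr mulf_eq0 (negbTE pa) subr_eq0 => /eqP.
Qed.

Definition mix t p q : {ffun A -> R} := [ffun a => t * p a + (1 - t) * q a].

Lemma is_dist_mix t p q : 0 <= t <= 1 -> is_dist p -> is_dist q ->
  is_dist (mix t p q).
Proof.
move=> /andP[t0 t1] [p0 ps] [q0 qs]; split=> [a|].
  by rewrite ffunE addr_ge0 // mulr_ge0 // subr_ge0.
under eq_bigr do rewrite ffunE.
by rewrite big_split /= -!mulr_sumr ps qs !mulr1 addrC subrK.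
Qed.

Lemma sum_mix t p q f :
  \sum_a mix t p q a * f a
    = t * (\sum_a p a * f a) + (1 - t) * (\sum_a q a * f a).
Proof.
rewrite !mulr_sumr -big_split; apply: eq_bigr => a _ /=.
by rewrite ffunE mulrDl !mulrA.
Qed.

End Distributions.

Section ExpectedPayoff.
Context {R : realType} {A1 A2 : finType}.
Implicit Types (u w : A1 -> A2 -> R).

Lemma exp_payoffE u s1 s2 :
  exp_payoff u s1 s2 = \sum_a s1 a * \sum_b s2 b * u a b.
Proof.
apply: eq_bigr => a _; rewrite mulr_sumr; apply: eq_bigr => b _.
by rewrite mulrA.
Qed.

Lemma exp_payoff_swap u s1 s2 :
  exp_payoff (fun b a => u a b) s2 s1 = exp_payoff u s1 s2.
Proof.
rewrite /exp_payoff exchange_big; apply: eq_bigr => a _; apply: eq_bigr => b _.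
by rewrite [s2 b * _]mulrC.
Qed.

Lemma exp_payoff_diracl u a s2 :
  exp_payoff u (dirac R a) s2 = \sum_b s2 b * u a b.
Proof. by rewrite exp_payoffE sum_dirac. Qed.

Lemma exp_payoff_dirac u a b :
  exp_payoff u (dirac R a) (dirac R b) = u a b.
Proof. by rewrite exp_payoff_diracl sum_dirac. Qed.

Lemma exp_payoffEl u s1 s2 :
  exp_payoff u s1 s2 = \sum_a s1 a * exp_payoff u (dirac R a) s2.
Proof.
by rewrite exp_payoffE; apply: eq_bigr => a _; rewrite exp_payoff_diracl.
Qed.

Lemma exp_payoff_mixl u t p q s2 : exp_payoff u (mix t p q) s2
  = t * exp_payoff u p s2 + (1 - t) * exp_payoff u q s2.
Proof. by rewrite !(exp_payoffEl _ _ s2) sum_mix. Qed.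

End ExpectedPayoff.

Section ExpectedPayoffRight.
Context {R : realType} {A1 A2 : finType}.
Implicit Types (u w : A1 -> A2 -> R).

Lemma exp_payoff_diracr u s1 b :
  exp_payoff u s1 (dirac R b) = \sum_a s1 a * u a b.
Proof. by rewrite -exp_payoff_swap exp_payoff_diracl. Qed.

Lemma exp_payoffEr u s1 s2 :
  exp_payoff u s1 s2 = \sum_b s2 b * exp_payoff u s1 (dirac R b).
Proof.
rewrite -exp_payoff_swap exp_payoffEl; apply: eq_bigr => b _.
by rewrite exp_payoff_swap.
Qed.

Lemma exp_payoff_mixr u t p q s1 : exp_payoff u s1 (mix t p q)
  = t * exp_payoff u s1 p + (1 - t) * exp_payoff u s1 q.
Proof. by rewrite !(exp_payoffEr _ s1) sum_mix. Qed.

Lemma eq_exp_payoff u w s1 s2 : (forall a b, u a b = w a b) ->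
  exp_payoff u s1 s2 = exp_payoff w s1 s2.
Proof. by move=> e; do 2!apply: eq_bigr => ? _; rewrite e. Qed.

Lemma exp_payoffD u w s1 s2 : exp_payoff (fun a b => u a b + w a b) s1 s2
  = exp_payoff u s1 s2 + exp_payoff w s1 s2.
Proof.
rewrite -big_split; apply: eq_bigr => a _; rewrite -big_split.
by apply: eq_bigr => b _; rewrite mulrDr.
Qed.

Lemma exp_payoff_const (c : R) (s1 : {ffun A1 -> R}) (s2 : {ffun A2 -> R}) :
  is_dist s1 -> is_dist s2 ->
  exp_payoff (fun _ _ => c) s1 s2 = c.
Proof. by move=> d1 d2; rewrite exp_payoffE !dist_sum_const. Qed.

Lemma exp_payoff_le u w s1 s2 : is_dist s1 -> is_dist s2 ->
  (forall a b, u a b <= w a b) -> exp_payoff u s1 s2 <= exp_payoff w s1 s2.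
Proof.
move=> [p1 _] [p2 _] uw; do 2!apply: ler_sum => ? _.
by rewrite ler_wpM2l // mulr_ge0.
Qed.

Lemma exp_payoff_attained u c s1 s2 : is_dist s1 -> is_dist s2 ->
  (forall a b, u a b <= c) -> exp_payoff u s1 s2 = c ->
  forall a b, s1 a != 0 -> s2 b != 0 -> u a b = c.
Proof.
move=> d1 d2 uc e a b na; move: b; apply: dist_sum_attained => //.
by rewrite -exp_payoff_diracl; move: a na; apply: (dist_sum_attained d1);
  [move=> a; rewrite exp_payoff_diracl; apply: dist_sum_le|rewrite -exp_payoffEl].
Qed.

Lemma exp_payoff_supp u c s1 s2 : is_dist s1 -> is_dist s2 ->
  (forall a b, s1 a != 0 -> s2 b != 0 -> u a b = c) ->
  exp_payoff u s1 s2 = c.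
Proof.
move=> d1 d2 uc; rewrite exp_payoffEl; apply: dist_sum_eq => // a na.
by rewrite exp_payoff_diracl; apply: dist_sum_eq => // b; apply: uc.
Qed.

(** A mixed payoff averages pure ones. This turns a profitable mixed deviation into the pure one
    demanded by the incentive conditions. *)
Lemma exp_payoff_gt_pure u c s1 s2 : is_dist s1 ->
  c < exp_payoff u s1 s2 -> exists a, c < exp_payoff u (dirac R a) s2.
Proof.
move=> d1 lt; apply/not_existsP => H; move: lt; apply/negP; rewrite -leNgt.
by rewrite exp_payoffEl; apply: dist_sum_le => // a; rewrite leNgt; apply/negP/H.
Qed.

End ExpectedPayoffRight.

Section Repeated.
Context {R : realType} {A1 A2 : finType}.
Implicit Types (u : A1 -> A2 -> R).
Let hist := seq (A1 * A2).

Lemma cont_payoffS u s1 s2 n h : cont_payoff u s1 s2 n.+1 h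
  = exp_payoff (fun a b => u a b + cont_payoff u s1 s2 n (rcons h (a, b)))
               (s1 h) (s2 h).
Proof. by []. Qed.

(** A continuation payoff consults only histories at least as long as [h], so a change at a shorter
    history does not affect it. *)
Lemma eq_cont_payoff u s1 s2 t1 t2 n h :
  (forall g, (size h <= size g)%N -> s1 g = t1 g /\ s2 g = t2 g) ->
  cont_payoff u s1 s2 n h = cont_payoff u t1 t2 n h.
Proof.
elim: n h => // n IH h e; rewrite !cont_payoffS.
have [-> ->] := e h (leqnn _); apply: eq_exp_payoff => a b; congr (_ + _).
by apply: IH => g; rewrite size_rcons => /ltnW; apply: e.
Qed.

Definition swaph (h : seq (A2 * A1)) : hist := [seq (x.2, x.1) | x <- h].

Lemma cont_payoff_swap u s1 s2 n (h : seq (A2 * A1)) :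
  cont_payoff (fun b a => u a b) (s2 \o swaph) (s1 \o swaph) n h
  = cont_payoff u s1 s2 n (swaph h).
Proof.
elim: n h => // n IH h; rewrite !cont_payoffS -[RHS]exp_payoff_swap.
apply: eq_exp_payoff => b a; congr (_ + _); apply: etrans (IH _) _.
by rewrite /swaph map_rcons.
Qed.

End Repeated.

Lemma swaphK (A1 A2 : finType) : cancel (@swaph A1 A2) (@swaph A2 A1).
Proof. by move=> h; rewrite /swaph -map_comp map_id_in // => -[]. Qed.

(** * Subgame perfect equilibria over a regime of available strategies *)

Lemma card_is1_or_gt1 (R : realType) (V : R -> Prop) :
  (exists v, V v) -> card_is1 V \/ card_gt1 V.
Proof.
case=> v Vv; have [|/existsNP[w /not_implyP[Vw wv]]] := pselect (forall w, V w -> w = v).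
  by move=> H; left; exists v => w; split=> [/H|->].
by right; exists v, w; split=> //; apply/nesym.
Qed.

(** [M] bounds every single excess [f a - c], so one [K] above [M / d] serves all actions. Later [K]
    counts the reward rounds that outweigh any one-stage gain. *)
Lemma archimedean_dominates (R : realType) (A : finType) (f : A -> R) (c d : R) :
  0 < d -> exists K : nat, forall a, f a <= c + d *+ K.
Proof.
move=> d0; pose M := \sum_a `|f a - c|; exists (Num.bound (M / d)) => a.
rewrite -lerBlDl; apply: le_trans (_ : M <= _).
  by rewrite /M (bigD1 a) //= ler_wpDr ?sumr_ge0 // ler_norm.
rewrite -mulr_natl -ler_pdivrMr // ltW // archi_boundP // divr_ge0 ?(ltW d0) //.
exact: sumr_ge0.
Qed.

Section Regime.
Context {R : realType} {A1 A2 : finType}.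
Variables (E1 : {ffun A1 -> R} -> Prop) (E2 : {ffun A2 -> R} -> Prop).
Variables (u1 u2 : A1 -> A2 -> R).
Let hist := seq (A1 * A2).

(** Availability is a predicate on mixed strategies so that both regimes are instances: [is_dist]
    gives the mixed one, Dirac measures give the pure one. *)
Definition nash s1 s2 : Prop :=
  [/\ E1 s1, E2 s2,
      (forall t1, E1 t1 -> exp_payoff u1 t1 s2 <= exp_payoff u1 s1 s2)
    & (forall t2, E2 t2 -> exp_payoff u2 s1 t2 <= exp_payoff u2 s1 s2)].

Definition nash_value (u : A1 -> A2 -> R) (v : R) : Prop :=
  exists s1 s2, nash s1 s2 /\ v = exp_payoff u s1 s2.

Definition spe (T : nat) (s1 : hist -> {ffun A1 -> R})
    (s2 : hist -> {ffun A2 -> R}) : Prop :=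
  [/\ forall h, E1 (s1 h), forall h, E2 (s2 h) &
  forall h : hist, (size h < T)%N ->
    (forall t1, (forall h, E1 (t1 h)) ->
       cont_payoff u1 t1 s2 (T - size h) h
       <= cont_payoff u1 s1 s2 (T - size h) h) /\
    (forall t2, (forall h, E2 (t2 h)) ->
       cont_payoff u2 s1 t2 (T - size h) h
       <= cont_payoff u2 s1 s2 (T - size h) h)].

Definition locally_suboptimal_spe : Prop :=
  exists T : nat, (1 <= T)%N /\
    exists (s1 : hist -> {ffun A1 -> R}) (s2 : hist -> {ffun A2 -> R}),
      spe T s1 s2 /\
      exists h : hist, (size h < T)%N /\ ~ nash (s1 h) (s2 h).

Hypotheses (E1_dist : forall s, E1 s -> is_dist s)
           (E2_dist : forall s, E2 s -> is_dist s).

(** * Necessity: the last suboptimal history *)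

Section Necessity.
Variables (T : nat) (s1 : hist -> {ffun A1 -> R}) (s2 : hist -> {ffun A2 -> R}).
Hypothesis s_spe : spe T s1 s2.

(** Deviating to [t] at [h] alone leaves every continuation worth [c], so [c] cancels from the
    equilibrium inequality and the stage inequality remains. *)
Lemma spe_stage1 (h : hist) c : (size h < T)%N ->
  (forall a b, cont_payoff u1 s1 s2 (T - (size h).+1) (rcons h (a, b)) = c) ->
  forall t, E1 t -> exp_payoff u1 t (s2 h) <= exp_payoff u1 (s1 h) (s2 h).
Proof.
case: s_spe => S1 S2 S hT hc t Et.
have d1 := E1_dist (S1 h); have d2 := E2_dist (S2 h); have dt := E1_dist Et.
pose t1 g := if g == h then t else s1 g.
have t1h : t1 h = t by rewrite /t1 eqxx.
have := (S h hT).1 t1; rewrite -subSS subSn // !cont_payoffS.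
have same a b : cont_payoff u1 t1 s2 (T - (size h).+1) (rcons h (a, b)) = c.
  rewrite -(hc a b); apply: eq_cont_payoff => g; rewrite size_rcons => lt.
  by rewrite /t1; case: eqP => // gh; rewrite gh ltnn in lt.
rewrite (eq_exp_payoff (w := fun a b => u1 a b + c)); last by move=> a b; rewrite same.
rewrite [leRHS](eq_exp_payoff (w := fun a b => u1 a b + c)); last by move=> a b; rewrite hc.
rewrite t1h !exp_payoffD !exp_payoff_const // lerD2r; apply=> g.
by rewrite /t1; case: ifP.
Qed.

Lemma spe_stage2 (h : hist) c : (size h < T)%N ->
  (forall a b, cont_payoff u2 s1 s2 (T - (size h).+1) (rcons h (a, b)) = c) ->
  forall t, E2 t -> exp_payoff u2 (s1 h) t <= exp_payoff u2 (s1 h) (s2 h).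
Proof.
case: s_spe => S1 S2 S hT hc t Et.
have d1 := E1_dist (S1 h); have d2 := E2_dist (S2 h); have dt := E2_dist Et.
pose t2 g := if g == h then t else s2 g.
have t2h : t2 h = t by rewrite /t2 eqxx.
have := (S h hT).2 t2; rewrite -subSS subSn // !cont_payoffS.
have same a b : cont_payoff u2 s1 t2 (T - (size h).+1) (rcons h (a, b)) = c.
  rewrite -(hc a b); apply: eq_cont_payoff => g; rewrite size_rcons => lt.
  by rewrite /t2; case: eqP => // gh; rewrite gh ltnn in lt.
rewrite (eq_exp_payoff (w := fun a b => u2 a b + c)); last by move=> a b; rewrite same.
rewrite [leRHS](eq_exp_payoff (w := fun a b => u2 a b + c)); last by move=> a b; rewrite hc.
rewrite t2h !exp_payoffD !exp_payoff_const // lerD2r; apply=> g.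
by rewrite /t2; case: ifP.
Qed.

Lemma cont_payoff_nash u v n (g : hist) :
  (forall t1 t2, nash t1 t2 -> exp_payoff u t1 t2 = v) ->
  (forall g' : hist, (size g <= size g' < size g + n)%N -> nash (s1 g') (s2 g')) ->
  cont_payoff u s1 s2 n g = v *+ n.
Proof.
move=> uv; elim: n g => // n IH g Hg; rewrite cont_payoffS.
rewrite (eq_exp_payoff (w := fun a b => u a b + v *+ n)); last first.
  move=> a b; rewrite IH // => g'; rewrite size_rcons addSnnS => /andP[lt lt'].
  by apply: Hg; rewrite (ltnW lt).
have N : nash (s1 g) (s2 g) by apply: Hg; lia.
case: (N) => /E1_dist d1 /E2_dist d2 _ _.
by rewrite exp_payoffD exp_payoff_const // uv // mulrS.
Qed.

(** Induction on the number of remaining rounds: replace [h] by a longer suboptimal history while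
    there is one. Lengths are compared across all branches, not only among extensions of [h]. *)
Lemma last_suboptimal (h : hist) : (size h < T)%N -> ~ nash (s1 h) (s2 h) ->
  exists g : hist, [/\ (size g < T)%N, ~ nash (s1 g) (s2 g) &
    forall g' : hist, (size g < size g' < T)%N -> nash (s1 g') (s2 g')].
Proof.
have [m] := ubnP (T - size h); elim: m h => // m IH h lt hT bad.
have [ok|/existsNP[g /not_implyP[/andP[hg gT] bg]]] := pselect
    (forall g' : hist, (size h < size g' < T)%N -> nash (s1 g') (s2 g')).
  by exists h.
by apply: IH bg => //; lia.
Qed.

End Necessity.

Hypotheses (E1_dirac : forall a, E1 (dirac R a)) (E2_dirac : forall b, E2 (dirac R b)).

Definition incentive_condition : Prop :=
  [\/ [/\ card_gt1 (nash_value u1), card_gt1 (nash_value u2) &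
        exists s1 s2, [/\ E1 s1, E2 s2 & ~ nash s1 s2]],
      [/\ card_gt1 (nash_value u1), card_is1 (nash_value u2) &
        exists s1 s2 (a1' : A1), [/\ E1 s1, E2 s2,
          exp_payoff u1 s1 s2 < exp_payoff u1 (dirac R a1') s2 &
          forall t2, E2 t2 -> exp_payoff u2 s1 t2 <= exp_payoff u2 s1 s2]]
    | [/\ card_is1 (nash_value u1), card_gt1 (nash_value u2) &
        exists s1 s2 (a2' : A2), [/\ E1 s1, E2 s2,
          exp_payoff u2 s1 s2 < exp_payoff u2 s1 (dirac R a2') &
          forall t1, E1 t1 -> exp_payoff u1 t1 s2 <= exp_payoff u1 s1 s2]]].

Lemma card_is1_nash_value u : card_is1 (nash_value u) ->
  exists v, forall s1 s2, nash s1 s2 -> exp_payoff u s1 s2 = v.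
Proof. by case=> v H; exists v => s1 s2 N; apply/H; exists s1, s2. Qed.

Lemma card_gt1_nash_value u : card_gt1 (nash_value u) ->
  exists p q : {ffun A1 -> R} * {ffun A2 -> R},
    [/\ nash p.1 p.2, nash q.1 q.2 & exp_payoff u q.1 q.2 < exp_payoff u p.1 p.2].
Proof.
move=> [v [w [[p1 [p2 [Np pv]]] [q1 [q2 [Nq qw]]] vw]]].
have /lt_total/orP[lt|lt] : v != w by apply/eqP.
  by exists (q1, q2), (p1, p2); rewrite -pv -qw.
by exists (p1, p2), (q1, q2); rewrite -pv -qw.
Qed.

Lemma not_nash_dev1 s1 s2 : E1 s1 -> E2 s2 -> ~ nash s1 s2 ->
  (forall t2, E2 t2 -> exp_payoff u2 s1 t2 <= exp_payoff u2 s1 s2) ->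
  exists a, exp_payoff u1 s1 s2 < exp_payoff u1 (dirac R a) s2.
Proof.
move=> e1 e2 nN br2; have [br1|] := pselect
  (forall t1, E1 t1 -> exp_payoff u1 t1 s2 <= exp_payoff u1 s1 s2).
  by case: nN.
move=> /existsNP[t /not_implyP[/E1_dist dt /negP]]; rewrite -ltNge.
exact: exp_payoff_gt_pure.
Qed.

Lemma not_nash_dev2 s1 s2 : E1 s1 -> E2 s2 -> ~ nash s1 s2 ->
  (forall t1, E1 t1 -> exp_payoff u1 t1 s2 <= exp_payoff u1 s1 s2) ->
  exists b, exp_payoff u2 s1 s2 < exp_payoff u2 s1 (dirac R b).
Proof.
move=> e1 e2 nN br1; have [br2|] := pselect
  (forall t2, E2 t2 -> exp_payoff u2 s1 t2 <= exp_payoff u2 s1 s2).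
  by case: nN.
move=> /existsNP[t /not_implyP[/E2_dist dt /negP]]; rewrite -ltNge.
rewrite -(exp_payoff_swap u2 s1 t) => lt; have [b ltb] := exp_payoff_gt_pure dt lt.
by exists b; rewrite -(exp_payoff_swap u2 s1 (dirac R b)).
Qed.

Lemma locally_suboptimal_incentive (a0 : A1) (b0 : A2) :
  locally_suboptimal_spe -> incentive_condition.
Proof.
move=> [T [_ [s1 [s2 [S [h0 [h0T bad0]]]]]]].
have [h [hT bad later]] := last_suboptimal h0T bad0.
have [S1 S2 _] := S.
(* The continuation is constant for one of two reasons: no round is left and it is 0, or all later
   profiles are Nash with the same value. *)
have cont u : (size h).+1 = T \/ card_is1 (nash_value u) ->
    exists c, forall a b, cont_payoff u s1 s2 (T - (size h).+1) (rcons h (a, b)) = c.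
  case=> [->|/card_is1_nash_value[v uv]]; first by exists 0; rewrite subnn.
  exists (v *+ (T - (size h).+1)) => a b; apply: cont_payoff_nash => // g.
  by rewrite size_rcons => gT; apply: later; lia.
have br1 : (size h).+1 = T \/ card_is1 (nash_value u1) ->
    forall t, E1 t -> exp_payoff u1 t (s2 h) <= exp_payoff u1 (s1 h) (s2 h).
  by move=> /cont[c cc]; apply: spe_stage1 cc.
have br2 : (size h).+1 = T \/ card_is1 (nash_value u2) ->
    forall t, E2 t -> exp_payoff u2 (s1 h) t <= exp_payoff u2 (s1 h) (s2 h).
  by move=> /cont[c cc]; apply: spe_stage2 cc.
have [lastT|ltT] := eqVneq (size h).+1 T.
  by case: bad; split=> //; [apply: br1|apply: br2]; left.
have N : nash (s1 (rcons h (a0, b0))) (s2 (rcons h (a0, b0))).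
  by apply: later; rewrite size_rcons; lia.
have ex u : exists v, nash_value u v.
  exists (exp_payoff u (s1 (rcons h (a0, b0))) (s2 (rcons h (a0, b0)))).
  by exists (s1 (rcons h (a0, b0))), (s2 (rcons h (a0, b0))).
have [c1|c1] := card_is1_or_gt1 (ex u1); have [c2|c2] := card_is1_or_gt1 (ex u2).
- by case: bad; split=> //; [apply: br1|apply: br2]; right.
- apply: Or33; split=> //; exists (s1 h), (s2 h).
  have br := br1 (or_intror c1).
  by have [b ltb] := not_nash_dev2 (S1 h) (S2 h) bad br; exists b; split.
- apply: Or32; split=> //; exists (s1 h), (s2 h).
  have br := br2 (or_intror c2).
  by have [a lta] := not_nash_dev1 (S1 h) (S2 h) bad br; exists a; split.
- by apply: Or31; split=> //; exists (s1 h), (s2 h).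
Qed.

(** * Sufficiency: one prescribed stage, then Nash play *)

Section OneStageThenNash.
Variables (N : nat) (s1 : {ffun A1 -> R}) (s2 : {ffun A2 -> R}).
Variable e : A1 * A2 -> nat -> {ffun A1 -> R} * {ffun A2 -> R}.
Hypotheses (E1s : E1 s1) (E2s : E2 s2).
Hypothesis e_nash : forall x j, nash (e x j).1 (e x j).2.

(** Play after the first outcome [x] depends only on [x] and the number of rounds since, [size g];
    later deviations thus leave the future play of the opponent unchanged. *)
Let S1 (h : hist) := if h is x :: g then (e x (size g)).1 else s1.
Let S2 (h : hist) := if h is x :: g then (e x (size g)).2 else s2.

Let path_payoff u x k n :=
  \sum_(j < n) exp_payoff u (e x (k + j)%N).1 (e x (k + j)%N).2.

Let path_payoffS u x k n : path_payoff u x k n.+1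
  = exp_payoff u (e x k).1 (e x k).2 + path_payoff u x k.+1 n.
Proof.
rewrite /path_payoff big_ord_recl addn0; congr (_ + _).
by apply: eq_bigr => j _; rewrite addSnnS.
Qed.

Let cont_path u n x g :
  cont_payoff u S1 S2 n (x :: g) = path_payoff u x (size g) n.
Proof.
elim: n g => [|n IH] g; first by rewrite /path_payoff big_ord0.
have [/E1_dist d1 /E2_dist d2 _ _] := e_nash x (size g).
rewrite cont_payoffS path_payoffS.
rewrite (eq_exp_payoff (w := fun a b => u a b + path_payoff u x (size g).+1 n)).
  by rewrite exp_payoffD exp_payoff_const.
by move=> a b; rewrite rcons_cons IH size_rcons.
Qed.

Let cont_path_dev1 t n x g : (forall h, E1 (t h)) ->
  cont_payoff u1 t S2 n (x :: g) <= path_payoff u1 x (size g) n.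
Proof.
move=> Et; elim: n g => [|n IH] g; first by rewrite /path_payoff big_ord0.
have [/E1_dist d1 /E2_dist d2 br _] := e_nash x (size g).
have dt := E1_dist (Et (x :: g)).
rewrite cont_payoffS path_payoffS.
apply: le_trans (exp_payoff_le
  (w := fun a b => u1 a b + path_payoff u1 x (size g).+1 n) dt _ _) _ => //.
  by move=> a b; rewrite lerD2l rcons_cons (le_trans (IH _)) // size_rcons.
by rewrite exp_payoffD exp_payoff_const // lerD2r br.
Qed.

Let cont_path_dev2 t n x g : (forall h, E2 (t h)) ->
  cont_payoff u2 S1 t n (x :: g) <= path_payoff u2 x (size g) n.
Proof.
move=> Et; elim: n g => [|n IH] g; first by rewrite /path_payoff big_ord0.
have [/E1_dist d1 /E2_dist d2 _ br] := e_nash x (size g).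
have dt := E2_dist (Et (x :: g)).
rewrite cont_payoffS path_payoffS.
apply: le_trans (exp_payoff_le
  (w := fun a b => u2 a b + path_payoff u2 x (size g).+1 n) _ dt _) _ => //.
  by move=> a b; rewrite lerD2l rcons_cons (le_trans (IH _)) // size_rcons.
by rewrite exp_payoffD exp_payoff_const // lerD2r br.
Qed.

Let W (u : A1 -> A2 -> R) a b :=
  u a b + \sum_(j < N) exp_payoff u (e (a, b) j).1 (e (a, b) j).2.

(** After the first round no deviation helps, since each scheduled profile is stage Nash and the
    schedule ignores later outcomes. At the root the game reduces to the one-shot game with payoffs
    [W]. *)
Lemma one_stage_then_nash :
  (forall t, E1 t -> exp_payoff (W u1) t s2 <= exp_payoff (W u1) s1 s2) ->
  (forall t, E2 t -> exp_payoff (W u2) s1 t <= exp_payoff (W u2) s1 s2) ->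
  ~ nash s1 s2 -> locally_suboptimal_spe.
Proof.
move=> ic1 ic2 bad; exists N.+1; split=> //; exists S1, S2; split; last by exists [::].
have ES1 h : E1 (S1 h) by case: h => //= x g; case: (e_nash x (size g)).
have ES2 h : E2 (S2 h) by case: h => //= x g; case: (e_nash x (size g)).
have d1 := E1_dist E1s; have d2 := E2_dist E2s.
have root u : cont_payoff u S1 S2 N.+1 [::] = exp_payoff (W u) s1 s2.
  by rewrite cont_payoffS; apply: eq_exp_payoff => a b; rewrite cont_path.
split=> // -[|x g] hT; split=> t Et; rewrite ?subn0 ?root ?cont_path.
- apply: le_trans (ic1 _ (Et [::])); rewrite cont_payoffS.
  apply: exp_payoff_le => // [|a b]; first exact: E1_dist.
  by rewrite lerD2l cont_path_dev1.
- apply: le_trans (ic2 _ (Et [::])); rewrite cont_payoffS.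
  apply: exp_payoff_le => // [|a b]; first exact: E2_dist.
  by rewrite lerD2l cont_path_dev2.
- exact: cont_path_dev1.
- exact: cont_path_dev2.
Qed.

End OneStageThenNash.

(** A deviation in outcome from a pure profile is always visible, so each player can be deterred by
    a punishment path of his own. *)
Lemma suboptimal_pure_profile a b :
  card_gt1 (nash_value u1) -> card_gt1 (nash_value u2) ->
  ~ nash (dirac R a) (dirac R b) -> locally_suboptimal_spe.
Proof.
move=> gt1 gt2 bad.
have [x [y [Nx Ny yx]]] := card_gt1_nash_value gt1.
have [z [w [Nz Nw wz]]] := card_gt1_nash_value gt2.
pose U u (p : {ffun A1 -> R} * {ffun A2 -> R}) := exp_payoff u p.1 p.2.
(* Rewarding with [x] and [z] equally often must beat punishing player 1 by [p]
   (and player 2 by [q]) forever. *)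
have [p [Np px pz]] : exists p, [/\ nash p.1 p.2, U u1 p < U u1 x & U u1 p <= U u1 z].
  have [yz|zy] := leP (U u1 y) (U u1 z); first by exists y.
  by exists z; split=> //; apply: lt_trans yx.
have [q [Nq qz qx]] : exists q, [/\ nash q.1 q.2, U u2 q < U u2 z & U u2 q <= U u2 x].
  have [wx|xw] := leP (U u2 w) (U u2 x); first by exists w.
  by exists x; split=> //; apply: lt_trans wz.
have [K1 HK1] := @archimedean_dominates R A1 (fun a' => u1 a' b) (u1 a b)
                   (U u1 x - U u1 p) ltac:(by rewrite subr_gt0).
have [K2 HK2] := @archimedean_dominates R A2 (fun b' => u2 a b') (u2 a b)
                   (U u2 z - U u2 q) ltac:(by rewrite subr_gt0).
pose K := (K1 + K2)%N.
(* [p] punishes player 1 and [q] player 2. Testing player 1 first matters only for joint deviations,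
   which the first-round inequalities never compare. On the path [x] and [z] get [K] rounds each. *)
pose e (c : A1 * A2) (j : nat) := if c.1 != a then p else if c.2 != b then q
  else if (j < K)%N then x else z.
have sum_e u c : \sum_(j < K + K) U u (e c j) =
    if c.1 != a then U u p *+ (K + K) else if c.2 != b then U u q *+ (K + K)
    else U u x *+ K + U u z *+ K.
  rewrite /e; case: ifP => _; first by rewrite sumr_const card_ord.
  case: ifP => _; first by rewrite sumr_const card_ord.
  rewrite big_split_ord /=; congr (_ + _).
    by under eq_bigr do rewrite ltn_ord; rewrite sumr_const card_ord.
  by under eq_bigr do rewrite ltnNge leq_addr; rewrite sumr_const card_ord.
apply: (@one_stage_then_nash (K + K)%N _ _ e (E1_dirac a) (E2_dirac b)) => //.
- by move=> c j; rewrite /e; do 3![case: ifP => // _].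
- move=> t /E1_dist dt; rewrite exp_payoff_diracr exp_payoff_dirac.
  apply: dist_sum_le => // a'; rewrite !(sum_e u1 (_, _)) /= !eqxx /=.
  have [->|_] := eqVneq a' a => //=.
  (* [K] rounds of [x] instead of [p] cover the gain from [a'], and the [K] rounds of [z] are no
     worse than [p]. *)
  have := HK1 a'; have := ler_wMn2r K pz.
  have : (U u1 x - U u1 p) *+ K1 <= (U u1 x - U u1 p) *+ K.
    by apply: ler_wpMn2l; [rewrite subr_ge0 ltW|apply: leq_addr].
  rewrite !mulrnBl mulrnDr; lra.
- move=> t /E2_dist dt; rewrite exp_payoff_diracl exp_payoff_dirac.
  apply: dist_sum_le => // b'; rewrite !(sum_e u2 (_, _)) /= !eqxx /=.
  have [->|_] := eqVneq b' b => //=.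
  have := HK2 b'; have := ler_wMn2r K qx.
  have : (U u2 z - U u2 q) *+ K2 <= (U u2 z - U u2 q) *+ K.
    by apply: ler_wpMn2l; [rewrite subr_ge0 ltW|apply: leq_addl].
  rewrite !mulrnBl mulrnDr; lra.
Qed.

(** * Sufficiency when player 2 has a single Nash value *)

Section ConstantForPlayer2.
Variables (s1 : {ffun A1 -> R}) (s2 : {ffun A2 -> R}).
Hypotheses (E1s : E1 s1) (E2s : E2 s2).
Hypothesis br2 : forall t2, E2 t2 -> exp_payoff u2 s1 t2 <= exp_payoff u2 s1 s2.
Hypothesis s_bad : ~ nash s1 s2.
Hypothesis V2_is1 : card_is1 (nash_value u2).

(** Every Nash continuation is worth [v *+ N] to player 2, so [br2] settles his incentives. For
    player 1, the actions in the support of [s1] all total [c] and no action exceeds it. *)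
Lemma suboptimal_compensated N (e : A1 -> nat -> {ffun A1 -> R} * {ffun A2 -> R}) c :
  (forall a j, nash (e a j).1 (e a j).2) ->
  (forall a, exp_payoff u1 (dirac R a) s2
     + \sum_(j < N) exp_payoff u1 (e a j).1 (e a j).2 <= c) ->
  (forall a, s1 a != 0 -> exp_payoff u1 (dirac R a) s2
     + \sum_(j < N) exp_payoff u1 (e a j).1 (e a j).2 = c) ->
  locally_suboptimal_spe.
Proof.
move=> Ne le_c eq_c; have [v u2v] := card_is1_nash_value V2_is1.
have d1 := E1_dist E1s; have d2 := E2_dist E2s.
apply: (@one_stage_then_nash N s1 s2 (fun x => e x.1)) => //= t Et.
  have dt := E1_dist Et.
  pose w a b := u1 a b + \sum_(j < N) exp_payoff u1 (e a j).1 (e a j).2.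
  have wE a : exp_payoff w (dirac R a) s2 = exp_payoff u1 (dirac R a) s2
     + \sum_(j < N) exp_payoff u1 (e a j).1 (e a j).2.
    rewrite !exp_payoff_diracl -[X in _ + X](dist_sum_const _ d2) -big_split /=.
    by apply: eq_bigr => b _; rewrite /w mulrDr.
  rewrite -/w [leRHS]exp_payoffEl (dist_sum_eq (c := c)) //; last first.
    by move=> a na; rewrite wE eq_c.
  by rewrite exp_payoffEl dist_sum_le // => a; rewrite wE.
have dt := E2_dist Et.
have cst a b : u2 a b + \sum_(j < N) exp_payoff u2 (e a j).1 (e a j).2 = u2 a b + v *+ N.
  by rewrite (eq_bigr (fun=> v)) ?sumr_const ?card_ord // => j _; rewrite u2v.
rewrite !(eq_exp_payoff _ _ cst) !exp_payoffD !exp_payoff_const // lerD2r.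
exact: br2.
Qed.

(** Actions in [S] earn [c] now and the better Nash profile [p] afterwards; any other action
    triggers [q] for [K] rounds, which offsets whatever it gains now. *)
Lemma suboptimal_rewarded (S : pred A1) c :
  (forall a, s1 a != 0 -> S a) ->
  (forall a, S a -> exp_payoff u1 (dirac R a) s2 = c) ->
  card_gt1 (nash_value u1) -> locally_suboptimal_spe.
Proof.
move=> supp_S S_c gt1.
have [p [q [Np Nq qp]]] := card_gt1_nash_value gt1.
have [K HK] := @archimedean_dominates R A1 (fun a => exp_payoff u1 (dirac R a) s2) c
                   (exp_payoff u1 p.1 p.2 - exp_payoff u1 q.1 q.2) ltac:(by rewrite subr_gt0).
apply: (@suboptimal_compensated K (fun a _ => if S a then p else q)
         (c + exp_payoff u1 p.1 p.2 *+ K)) => [a _|a|a /supp_S Sa].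
- by case: ifP.
- case: ifP => [/S_c->|_]; rewrite sumr_const card_ord //.
  by have := HK a; rewrite mulrnBl; lra.
- by rewrite Sa S_c // sumr_const card_ord.
Qed.

(* With a continuum of Nash values for player 1, the continuation can make her
   exactly indifferent between all actions. *)
Lemma suboptimal_equalized x y : x < y ->
  (forall w, x <= w <= y -> nash_value u1 w) -> locally_suboptimal_spe.
Proof.
move=> xy V1xy; pose f a := exp_payoff u1 (dirac R a) s2.
(* This [K] makes [f a / K.+1] at most half the interval length in absolute value, so the midpoint
   minus it is a Nash value. Using [K.+1] rounds avoids a division by zero. *)
have [K HK] := @archimedean_dominates R A1 (fun a => `|f a|) 0
                   ((y - x) / 2) ltac:(by rewrite divr_gt0 ?subr_gt0).
have K0 : (0 : R) < K.+1%:R by rewrite ltr0n.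
have /choice[e He] : forall a, exists p : {ffun A1 -> R} * {ffun A2 -> R},
    nash p.1 p.2 /\ exp_payoff u1 p.1 p.2 = (x + y) / 2 - f a / K.+1%:R.
  move=> a.
  have [|p1 [p2 [Np pv]]] := V1xy ((x + y) / 2 - f a / K.+1%:R); last by exists (p1, p2).
  have : `|f a / K.+1%:R| <= (y - x) / 2.
    rewrite normrM normfV (gtr0_norm K0) ler_pdivrMr //.
    have := HK a; rewrite add0r => /le_trans; apply.
    by rewrite mulr_natr ler_wpMn2l // divr_ge0 // subr_ge0 ltW.
  move: (f a / _) => r; rewrite ler_norml => /andP[? ?]; apply/andP; split; lra.
have tot a : f a + \sum_(j < K.+1) exp_payoff u1 (e a).1 (e a).2
    = (x + y) / 2 * K.+1%:R.
  rewrite sumr_const card_ord (He a).2 -[(_ - _) *+ _]mulr_natr mulrBl divfK ?gt_eqF //.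
  by rewrite addrCA subrr addr0.
apply: (@suboptimal_compensated K.+1 (fun a _ => e a) ((x + y) / 2 * K.+1%:R)).
- by move=> a _; case: (He a).
- by move=> a; rewrite -/(f a) tot.
- by move=> a _; rewrite -/(f a) tot.
Qed.

End ConstantForPlayer2.

Lemma suboptimal_pure_rewarded a a' b :
  card_gt1 (nash_value u1) -> card_is1 (nash_value u2) ->
  u1 a b < u1 a' b -> (forall b', u2 a b' <= u2 a b) -> locally_suboptimal_spe.
Proof.
move=> gt1 is1 lt best.
apply: (suboptimal_rewarded (E1_dirac a) (E2_dirac b) _ _ is1 (S := pred1 a) (c := u1 a b)).
- move=> t /E2_dist dt; rewrite exp_payoff_diracl exp_payoff_dirac.
  exact: dist_sum_le.
- case=> _ _ /(_ _ (E1_dirac a')) + _.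
  by rewrite !exp_payoff_dirac leNgt lt.
- by move=> k; rewrite ffunE pnatr_eq0 eqb0 negbK.
- by move=> k /eqP->; rewrite exp_payoff_dirac.
- exact: gt1.
Qed.

End Regime.

(** * Symmetry between the players *)

Section Swap.
Context {R : realType} {A1 A2 : finType}.
Variables (E1 : {ffun A1 -> R} -> Prop) (E2 : {ffun A2 -> R} -> Prop).
Variables (u1 u2 : A1 -> A2 -> R).
Let u1' b a := u1 a b.
Let u2' b a := u2 a b.

Lemma nash_swap s1 s2 : nash E2 E1 u2' u1' s2 s1 <-> nash E1 E2 u1 u2 s1 s2.
Proof.
rewrite /nash !(exp_payoff_swap _ s1 s2).
split=> -[? ? br br']; split=> // t Et.
- by rewrite -exp_payoff_swap br'.
- by rewrite -exp_payoff_swap br.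
- by rewrite (exp_payoff_swap u2 s1 t) br'.
- by rewrite (exp_payoff_swap u1 t s2) br.
Qed.

Lemma nash_value_swap u :
  nash_value E2 E1 u2' u1' (fun b a => u a b) = nash_value E1 E2 u1 u2 u.
Proof.
apply/funext => v; apply/propext.
by split=> -[s [t [/nash_swap N ->]]]; exists t, s; split=> //; rewrite exp_payoff_swap.
Qed.

Lemma locally_suboptimal_swap :
  locally_suboptimal_spe E2 E1 u2' u1' -> locally_suboptimal_spe E1 E2 u1 u2.
Proof.
move=> [T [T0 [s2 [s1 [[S2 S1 S] [h [hT bad]]]]]]]; exists T; split=> //.
exists (s1 \o @swaph A2 A1), (s2 \o @swaph A2 A1); split; last first.
  exists (swaph h); rewrite size_map; split=> //= /nash_swap.
  by rewrite swaphK.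
split=> [g|g|g gT]; [exact: S1|exact: S2|].
have := S (swaph g); rewrite !size_map => /(_ gT)[br2 br1].
have id_swap B (t : seq (A1 * A2) -> B) : t = (t \o @swaph A1 A2) \o @swaph A2 A1.
  by apply/funext => k /=; rewrite swaphK.
split=> t Et.
  rewrite [t]id_swap !(cont_payoff_swap u1'). apply: br1 => k; exact: Et.
rewrite [t]id_swap !(cont_payoff_swap u2'); apply: br2 => k; exact: Et.
Qed.

End Swap.

(** * The mixed regime *)

Section EnvelopeCrossing.
Context {R : realType} {C : finType}.
Variables (f g : C -> R).
Let L (t : R) c := t * f c + (1 - t) * g c.
(** Upper envelope over [Q]; the default line is that of [c0], to be taken in [Q], so that the
    maximum is attained inside [Q]. *)
Let M (Q : pred C) c0 t := \big[Num.max/L t c0]_(c | Q c) L t c.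

Let M_attained (Q : pred C) c0 t : Q c0 -> exists2 c, Q c & M Q c0 t = L t c.
Proof.
move=> Qc0; rewrite /M; elim/big_ind: _ => [|x y [c Qc ->] [d Qd ->]|c Qc].
- by exists c0.
- by case: (leP (L t c) (L t d)) => _; [exists d|exists c].
- by exists c.
Qed.

Let M_continuous (Q : pred C) c0 : continuous (M Q c0 : R^o -> R^o).
Proof.
have Lc c : continuous (L ^~ c : R^o -> R^o).
  move=> t; rewrite /L /continuous_at; apply: cvgD.
    by apply: cvgM; [exact: cvg_id|exact: cvg_cst].
  by apply: cvgM; [apply: cvgB; [exact: cvg_cst|exact: cvg_id]|exact: cvg_cst].
rewrite /M; elim: (index_enum C) => [|c s IH] t.
  by under eq_fun do rewrite big_nil; apply: Lc.
under eq_fun do rewrite big_cons; case: (Q c); last exact: IH.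
exact: (continuous_max (Lc c t) (IH t)).
Qed.

(* The upper envelope of the lines [L ^~ c] is attained in [P] at 1 and off [P]
   at 0, hence somewhere in between by both kinds of lines at once. *)
Lemma envelope_crossing (P : pred C) p0 q0 : P p0 -> ~~ P q0 ->
  (forall c, ~~ P c -> f c < f p0) -> (forall c, P c -> g c < g q0) ->
  exists t p q, [/\ 0 < t < 1, P p, ~~ P q &
    forall c, t * f c + (1 - t) * g c <= t * f p + (1 - t) * g p
           /\ t * f c + (1 - t) * g c <= t * f q + (1 - t) * g q].
Proof.
move=> Pp0 Pq0 fP gP; pose MP := M P p0; pose MQ := M (predC P) q0.
have MP_ge t c : P c -> L t c <= MP t by move=> Pc; apply: le_bigmax_cond.
have MQ_ge t c : ~~ P c -> L t c <= MQ t by move=> Pc; apply: le_bigmax_cond.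
have h0 : MP 0 < MQ 0.
  have [c Pc MPc] := M_attained 0 Pp0; rewrite /MP MPc; apply: lt_le_trans (MQ_ge 0 _ Pq0).
  by rewrite /L !mul0r !add0r subr0 !mul1r gP.
have h1 : MQ 1 < MP 1.
  have [c Pc MQc] := M_attained (Q := predC P) 1 Pq0; rewrite /MQ MQc.
  apply: lt_le_trans (MP_ge 1 _ Pp0).
  by rewrite /L !mul1r subrr !mul0r !addr0 fP.
have [t] : exists2 t, t \in `[0, 1] & MP t - MQ t = 0.
  apply: (@IVT R (fun t => MP t - MQ t)) => //.
    apply: continuous_subspaceT => t.
    by apply: cvgB; apply: M_continuous.
  by rewrite ge_min le_max !subr_le0 !subr_ge0 (ltW h0) (ltW h1) orbT.
rewrite in_itv /= => /andP[t0 t1] /eqP; rewrite subr_eq0 => /eqP MPQ.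
have [p Pp MPp] := M_attained t Pp0.
have [q Pq MQq] := M_attained (Q := predC P) t Pq0.
exists t, p, q; split=> // [|c].
  rewrite !lt_neqAle t0 t1 !andbT; apply/andP; split; apply/eqP => te.
    by rewrite te MPQ ltxx in h0.
  by rewrite -te MPQ ltxx in h1.
rewrite -/(L t c) -/(L t p) -/(L t q) -MPp -MQq -/(MP t) -/(MQ t) -MPQ.
suff le : L t c <= MP t by [].
by have [/(MP_ge t)//|/(MQ_ge t)] := boolP (P c); rewrite -MPQ.
Qed.

End EnvelopeCrossing.

Section Mixed.
Context {R : realType} {A1 A2 : finType}.
Variables (u1 u2 : A1 -> A2 -> R).

Lemma all_pure_nash_mixed s1 s2 : (forall a b, NashPP u1 u2 a b) ->
  is_dist s1 -> is_dist s2 -> NashMM u1 u2 s1 s2.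
Proof.
move=> N d1 d2; split=> // t dt.
  rewrite !(exp_payoffEr _ _ s2); apply: ler_sum => b _; apply: ler_wpM2l.
    by case: d2.
  rewrite !exp_payoff_diracr (dist_sum_le (c := \sum_a s1 a * u1 a b)) // => a.
  rewrite -(dist_sum_const (u1 a b) d1); apply: ler_sum => a' _.
  by apply: ler_wpM2l; [case: d1|case: (N a' b)].
rewrite !(exp_payoffEl _ s1); apply: ler_sum => a _; apply: ler_wpM2l.
  by case: d1.
rewrite !exp_payoff_diracl (dist_sum_le (c := \sum_b s2 b * u2 a b)) // => b.
rewrite -(dist_sum_const (u2 a b) d2); apply: ler_sum => b' _.
by apply: ler_wpM2l; [case: d2|case: (N a b')].
Qed.

Lemma NashMM_dirac a b : NashPP u1 u2 a b -> NashMM u1 u2 (dirac R a) (dirac R b).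
Proof.
case=> br1 br2; split; try exact: is_dist_dirac; move=> t dt; rewrite exp_payoff_dirac.
  by rewrite exp_payoff_diracr dist_sum_le.
by rewrite exp_payoff_diracl dist_sum_le.
Qed.

(** [p] and [q] are both best replies to [s1], hence equally good for player 2, and the inequalities
    of player 1 average. Varying [t] sweeps all her values between the two. *)
Lemma NashMM_mixr t s1 p q : 0 <= t <= 1 -> NashMM u1 u2 s1 p ->
  NashMM u1 u2 s1 q -> NashMM u1 u2 s1 (mix t p q).
Proof.
move=> t01 [d1 dp p1 p2] [_ dq q1 q2]; have /andP[t0 t1] := t01.
have u2pq : exp_payoff u2 s1 p = exp_payoff u2 s1 q.
  by apply/le_anti; rewrite p2 // q2.
split=> // [|k dk|k dk]; first exact: is_dist_mix.
  rewrite !exp_payoff_mixr lerD // ler_wpM2l ?p1 ?q1 // subr_ge0 //.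
by rewrite exp_payoff_mixr u2pq -mulrDl addrC subrK mul1r -u2pq p2.
Qed.

Lemma pure_best_response (b0 : A2) a : exists b, forall b', u2 a b' <= u2 a b.
Proof. by case: (@arg_maxP _ _ _ b0 xpredT (u2 a) isT) => b _ H; exists b => b'; apply: H. Qed.

Lemma zero_between (x y : R) : y <= 0 <= x ->
  exists2 m, 0 <= m <= 1 & m * x + (1 - m) * y = 0.
Proof.
case/andP=> y0 x0; have [xy|xy] := eqVneq (x - y) 0.
  by exists 1; [rewrite ler01 lexx|rewrite subrr mul0r addr0 mul1r; lra].
have xy0 : 0 < x - y by rewrite lt_neqAle eq_sym xy; lra.
exists (- y / (x - y)); last by field.
by rewrite ler_pdivlMr // ler_pdivrMr // mul0r mul1r; lra.
Qed.

Hypothesis V1_gt1 : card_gt1 (V1mm u1 u2).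
Hypothesis V2_is1 : card_is1 (V2mm u1 u2).

Lemma mixed_locally_suboptimal (a0 : A1) (b0 : A2) s1 s2 a' :
  is_dist s1 -> is_dist s2 ->
  exp_payoff u1 s1 s2 < exp_payoff u1 (dirac R a') s2 ->
  (forall t2, is_dist t2 -> exp_payoff u2 s1 t2 <= exp_payoff u2 s1 s2) ->
  locally_suboptimal_spe (@is_dist R A1) (@is_dist R A2) u1 u2.
Proof.
move=> d1 d2 lt br2; have [v u2v] := card_is1_nash_value V2_is1.
have idA1 (s : {ffun A1 -> R}) : is_dist s -> is_dist s by [].
have idA2 (s : {ffun A2 -> R}) : is_dist s -> is_dist s by [].
have [[x [y [xy itv]]]|noA] := pselect (exists x y,
    x < y /\ forall w, x <= w <= y -> V1mm u1 u2 w).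
  apply: (suboptimal_equalized idA1 idA2 d1 d2 br2 _ V2_is1 xy itv).
  by case=> _ _ /(_ _ (is_dist_dirac a')) + _; rewrite leNgt lt.
have [[a [b [best [a1 lt1]]]]|noB] := pselect (exists a b,
    (forall b', u2 a b' <= u2 a b) /\ exists a1, u1 a b < u1 a1 b).
  exact: (suboptimal_pure_rewarded idA1 idA2 (@is_dist_dirac R A1)
            (@is_dist_dirac R A2) V1_gt1 V2_is1 lt1 best).
(* By [noB], a best reply to a pure action always yields a pure Nash profile. Hence [v] is the
   maximum of [u2], reached exactly at the pure Nash profiles. *)
have N a b : (forall b', u2 a b' <= u2 a b) -> NashPP u1 u2 a b.
  move=> best; split=> // a1; rewrite leNgt; apply/negP => lt1; apply: noB.
  by exists a, b; split=> //; exists a1.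
have N_v a b : NashPP u1 u2 a b -> u2 a b = v.
  by move/NashMM_dirac/u2v; rewrite exp_payoff_dirac.
have le_v a b : u2 a b <= v.
  by have [c best] := pure_best_response b0 a; rewrite -(N_v _ _ (N _ _ best)).
have v_N a b : u2 a b = v -> NashPP u1 u2 a b by move=> ab; apply: N => b'; rewrite ab.
(* Two best replies to [a] with different [u1] would, when mixed, give an interval of Nash values,
   which [noA] excludes. *)
have no_lt a b c : u2 a b = v -> u2 a c = v -> ~ u1 a b < u1 a c.
  move=> /v_N/NashMM_dirac Nb /v_N/NashMM_dirac Nc bc; apply: noA.
  exists (u1 a b), (u1 a c); split=> // w /andP[bw wc].
  have bc0 : 0 < u1 a c - u1 a b by rewrite subr_gt0.
  exists (dirac R a), (mix ((w - u1 a b) / (u1 a c - u1 a b)) (dirac R c) (dirac R b)).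
  split; first (apply: NashMM_mixr => //).
    by rewrite ler_pdivlMr // ler_pdivrMr // mul0r mul1r; lra.
  by rewrite exp_payoff_mixr !exp_payoff_dirac; field; rewrite gt_eqF.
have u1_eq a b c : u2 a b = v -> u2 a c = v -> u1 a b = u1 a c.
  move=> ab ac; apply/eqP; rewrite eq_le !leNgt.
  by apply/andP; split; apply/negP; apply: no_lt.
(* Otherwise [u1] is constant on the cells where [u2] equals [v]. A mixed Nash profile attains the
   maximum [v], so it is supported on such cells, and player 1 would have one Nash value. *)
have [a [d [c [e [ac de ne]]]]] : exists a d c e,
    [/\ u2 a c = v, u2 d e = v & u1 a c <> u1 d e].
  apply: contrapT => none; have [c0 best0] := pure_best_response b0 a0.
  have V1_const w : V1mm u1 u2 w -> w = u1 a0 c0.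
    move=> [p [q [Npq ->]]]; have [dp dq _ _] := Npq.
    apply: exp_payoff_supp => // a b pa qb; apply: contrapT => ne; apply: none.
    exists a, a0, b, c0; split=> //; last exact: (N_v _ _ (N _ _ best0)).
    exact: (exp_payoff_attained dp dq le_v (u2v _ _ Npq)).
  by have [w [w' [/V1_const-> /V1_const->]]] := V1_gt1.
have disjoint_best k : u2 a k = v -> u2 d k = v -> False.
  move=> ak dk; apply: ne; rewrite (u1_eq _ _ _ ac ak) (u1_eq _ _ _ de dk).
  by apply/le_anti; rewrite (v_N _ _ ak).1 (v_N _ _ dk).1.
(* Columns where player 1 prefers [a] to [d]. Ties are included exactly at best replies to [a], so
   that best replies to [a] lie in [P] and those to [d] outside. *)
pose P k := (u1 d k < u1 a k) || (u1 d k == u1 a k) && (u2 a k == v).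
have a_P k : u2 a k = v -> P k.
  move=> ak; rewrite /P ak eqxx andbT orbC -le_eqVlt.
  by case: (v_N _ _ ak).
have d_P k : u2 d k = v -> ~~ P k.
  move=> dk; rewrite /P negb_or -leNgt (v_N _ _ dk).1 /=.
  by apply/negP => /andP[_ /eqP ak]; apply: disjoint_best ak dk.
(* Against the mixture of [a] and [d] with weight [t], both [p] in [P] and [q] outside are best
   replies. *)
have [t [p [q [/andP[t0 t1] Pp Pq opt]]]] :=
    @envelope_crossing R A2 (u2 a) (u2 d) P c e (a_P _ ac) (d_P _ de)
    ltac:(by move=> k nPk; rewrite ac lt_neqAle le_v andbT;
             apply: contra nPk => /eqP/a_P)
    ltac:(by move=> k Pk; rewrite de lt_neqAle le_v andbT;
             apply: contraTneq Pk; apply: d_P).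
(* [p] weakly favours [a] and [q] weakly favours [d], so some mixture of [p] and [q] makes player 1
   indifferent between them. *)
have [m m01 m_ind] : exists2 m, 0 <= m <= 1 &
    m * (u1 a p - u1 d p) + (1 - m) * (u1 a q - u1 d q) = 0.
  apply: zero_between; rewrite subr_le0 subr_ge0; apply/andP; split.
    by rewrite leNgt; apply: contra Pq => lt1; rewrite /P lt1.
  by case/orP: Pp => [/ltW//|/andP[/eqP-> _]].
pose L k := t * u2 a k + (1 - t) * u2 d k.
have Lpq : L q = L p by apply/le_anti; rewrite (opt p).2 (opt q).1.
(* As [0 < t < 1], the payoff [v] at [p] would make [p] a best reply to both [a] and [d]. *)
have L_lt : L p < v.
  have := le_v a p; have := le_v d p; rewrite /L.
  case: (eqVneq (u2 a p) v) => [ap|/eqP ap] dle ale.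
    have : 0 < (1 - t) * (v - u2 d p).
      rewrite mulr_gt0 ?subr_gt0 // lt_neqAle dle andbT.
      by apply/eqP => dp; apply: disjoint_best ap dp.
    by rewrite ap; lra.
  have : 0 < t * (v - u2 a p).
    by rewrite mulr_gt0 ?subr_gt0 // lt_neqAle ale andbT; apply/eqP.
  have : 0 <= (1 - t) * (v - u2 d p) by rewrite mulr_ge0 ?subr_ge0 // ltW.
  lra.
pose r1 := mix t (dirac R a) (dirac R d); pose r2 := mix m (dirac R p) (dirac R q).
have dr1 : is_dist r1 by apply: is_dist_mix; rewrite ?ltW //; apply: is_dist_dirac.
have dr2 : is_dist r2 by apply: is_dist_mix => //; apply: is_dist_dirac.
have r1L k : exp_payoff u2 r1 (dirac R k) = L k.
  by rewrite exp_payoff_mixl !exp_payoff_dirac.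
have r12L : exp_payoff u2 r1 r2 = L p.
  by rewrite exp_payoff_mixr !r1L Lpq -mulrDl addrC subrK mul1r.
(* Against [r2] player 1 may prefer a third action to [a] and [d]; it lies outside [pred2 a d] and
   is punished. *)
apply: (suboptimal_rewarded idA1 idA2 dr1 dr2 _ _ V2_is1
    (S := pred2 a d) (c := exp_payoff u1 (dirac R a) r2)) => //.
- move=> k dk; rewrite r12L exp_payoffEr; apply: dist_sum_le => // b.
  by rewrite r1L (opt b).1.
- by move/u2v; rewrite r12L => Lv; rewrite Lv ltxx in L_lt.
- move=> k /=; apply: contraR; rewrite negb_or => /andP[/negbTE ka /negbTE kd].
  by rewrite !ffunE ka kd !mulr0 addr0.
- move=> k /orP[/eqP->//|/eqP->].
  rewrite !exp_payoff_mixr !exp_payoff_dirac; move: m_ind; lra.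
Qed.

End Mixed.

Lemma GLS_mmP (R : realType) (A1 A2 : finType) (a0 : A1) (b0 : A2)
    (u1 u2 : A1 -> A2 -> R) :
  GLS_mm u1 u2 <-> C_mm u1 u2.
Proof.
split.
  exact: (@locally_suboptimal_incentive R A1 A2 (@is_dist R A1) (@is_dist R A2)
            u1 u2 (fun _ => id) (fun _ => id) a0 b0).
have mm : locally_suboptimal_spe (@is_dist R A1) (@is_dist R A2) u1 u2 ->
    GLS_mm u1 u2 by [].
move=> [[gt1 gt2 [s1 [s2 [d1 d2 bad]]]]|[gt1 is1 [s1 [s2 [a [d1 d2 lt br]]]]]|].
(* The given profile may be mixed, so that deviations within its support go unnoticed; but then some
   pure profile is not Nash either and can replace it. *)
- have [a [b nN]] : exists a b, ~ NashPP u1 u2 a b.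
    apply: contrapT => none; apply: bad; apply: all_pure_nash_mixed => // a b.
    by apply: contrapT => nN; apply: none; exists a, b.
  apply/mm/(@suboptimal_pure_profile _ _ _ _ _ u1 u2 _ _ _ _ a b) => //;
    try exact: is_dist_dirac.
  move=> [_ _ br1 br2]; apply: nN; split=> k.
    by have := br1 _ (is_dist_dirac k); rewrite !exp_payoff_dirac.
  by have := br2 _ (is_dist_dirac k); rewrite !exp_payoff_dirac.
- exact/mm/(mixed_locally_suboptimal gt1 is1 a0 b0 d1 d2 lt br).
move=> [is1 gt2 [s1 [s2 [b [d1 d2 lt br]]]]]; apply/mm/locally_suboptimal_swap.
apply: (mixed_locally_suboptimal _ _ b0 a0 d2 d1 (a' := b)).
- by rewrite /V1mm -/(nash_value _ _ _ _ _) nash_value_swap.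
- by rewrite /V2mm -/(nash_value _ _ _ _ _) nash_value_swap.
- by rewrite (exp_payoff_swap u2 s1 s2) (exp_payoff_swap u2 s1 (dirac R b)).
- by move=> k dk; rewrite (exp_payoff_swap u1 k s2) (exp_payoff_swap u1 s1 s2) br.
Qed.

(** * The pure regime *)

Section Pure.
Context {R : realType} {A1 A2 : finType}.
Variables (u1 u2 : A1 -> A2 -> R).

Definition is_pure (A : finType) (s : {ffun A -> R}) := exists a, s = dirac R a.

Lemma is_pure_dist (A : finType) (s : {ffun A -> R}) : is_pure s -> is_dist s.
Proof. by case=> a ->; apply: is_dist_dirac. Qed.

Lemma is_pure_dirac (A : finType) (a : A) : is_pure (dirac R a).
Proof. by exists a. Qed.

Lemma is_pure_liftp (A : finType) (s : seq (A1 * A2) -> {ffun A -> R}) :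
  (forall h, is_pure (s h)) -> exists m, s = liftp R m.
Proof. by move=> /choice[m sm]; exists m; apply/funext. Qed.

Lemma NashPP_dirac a b :
  NashPP u1 u2 a b <->
  nash (@is_pure A1) (@is_pure A2) u1 u2 (dirac R a) (dirac R b).
Proof.
split=> [[br1 br2]|[_ _ br1 br2]].
  by split; try exact: is_pure_dirac; move=> _ [k ->]; rewrite !exp_payoff_dirac.
split=> k.
  by have := br1 _ (is_pure_dirac k); rewrite !exp_payoff_dirac.
by have := br2 _ (is_pure_dirac k); rewrite !exp_payoff_dirac.
Qed.

Lemma pure_nash_value u v :
  (exists a b, NashPP u1 u2 a b /\ v = u a b) <->
  nash_value (@is_pure A1) (@is_pure A2) u1 u2 u v.
Proof.
split=> [[a [b [/NashPP_dirac N ->]]]|[s [t [N ->]]]].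
  by exists (dirac R a), (dirac R b); rewrite exp_payoff_dirac.
have [[a sa] [b tb] _ _] := N; exists a, b.
by rewrite sa tb in N *; rewrite exp_payoff_dirac; split=> //; apply/NashPP_dirac.
Qed.

Lemma V1ppE : V1pp u1 u2 = nash_value (@is_pure A1) (@is_pure A2) u1 u2 u1.
Proof. by apply/funext => v; apply/propext; apply: pure_nash_value. Qed.

Lemma V2ppE : V2pp u1 u2 = nash_value (@is_pure A1) (@is_pure A2) u1 u2 u2.
Proof. by apply/funext => v; apply/propext; apply: pure_nash_value. Qed.

Lemma GLS_pp_pure :
  GLS_pp u1 u2 <-> locally_suboptimal_spe (@is_pure A1) (@is_pure A2) u1 u2.
Proof.
split=> [[T [T0 [m1 [m2 [S [h [hT bad]]]]]]]|[T [T0 [s1 [s2 [[S1 S2 S] [h [hT bad]]]]]]]];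
    exists T; split=> //.
  exists (liftp R m1), (liftp R m2); split; last by exists h; split=> // /NashPP_dirac.
  split=> [k|k|k kT]; try exact: is_pure_dirac.
  have [br1 br2] := S k kT.
  by split=> _ /is_pure_liftp[m ->]; [apply: br1|apply: br2].
have [m1 s1E] := is_pure_liftp S1; have [m2 s2E] := is_pure_liftp S2.
rewrite s1E s2E in S bad; exists m1, m2; split.
  by move=> k kT; have [br1 br2] := S k kT; split=> t; [apply: br1|apply: br2] => g;
    apply: is_pure_dirac.
by exists h; split=> // /NashPP_dirac.
Qed.

End Pure.

Lemma GLS_ppP (R : realType) (A1 A2 : finType) (a0 : A1) (b0 : A2)
    (u1 u2 : A1 -> A2 -> R) :
  GLS_pp u1 u2 <-> C_pp u1 u2.
Proof.
rewrite GLS_pp_pure /C_pp V1ppE V2ppE; split.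
  case/(locally_suboptimal_incentive (@is_pure_dist R A1) (@is_pure_dist R A2) a0 b0).
  - move=> [gt1 gt2 [_ [_ [[a ->] [b ->] nN]]]].
    by apply: Or31; split=> //; exists a, b => /NashPP_dirac.
  - move=> [gt1 is1 [_ [_ [a' [[a ->] [b ->] lt br]]]]].
    rewrite !exp_payoff_dirac in lt; apply: Or32; split=> //; exists a, a', b.
    by split=> // k; have := br _ (is_pure_dirac k); rewrite !exp_payoff_dirac.
  - move=> [is1 gt2 [_ [_ [b' [[a ->] [b ->] lt br]]]]].
    rewrite !exp_payoff_dirac in lt; apply: Or33; split=> //; exists a, b, b'.
    by split=> // k; have := br _ (is_pure_dirac k); rewrite !exp_payoff_dirac.
move=> [[gt1 gt2 [a [b nN]]]|[gt1 is1 [a [a' [b [lt best]]]]]|].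
- apply: (suboptimal_pure_profile (@is_pure_dist R A1) (@is_pure_dist R A2)
    (@is_pure_dirac R A1) (@is_pure_dirac R A2) (a := a) (b := b)) => //.
  by move/NashPP_dirac.
- exact: (suboptimal_pure_rewarded (@is_pure_dist R A1) (@is_pure_dist R A2)
    (@is_pure_dirac R A1) (@is_pure_dirac R A2) gt1 is1 lt best).
move=> [is1 gt2 [a [b [b' [lt best]]]]]; apply: locally_suboptimal_swap.
apply: (suboptimal_pure_rewarded (@is_pure_dist R A2) (@is_pure_dist R A1)
    (@is_pure_dirac R A2) (@is_pure_dirac R A1) _ _ lt best); by rewrite nash_value_swap.
Qed.

(** * Comparison of the regimes *)

(** Each clause of [C_mm] exhibits a mixed profile that is not Nash, impossible if all pure profiles
    were Nash. *)
Lemma C_mm_not_nash (R : realType) (A1 A2 : finType) (u1 u2 : A1 -> A2 -> R) :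
  C_mm u1 u2 -> exists a b, ~ NashPP u1 u2 a b.
Proof.
move=> C; apply: contrapT => none.
have all_nash s1 s2 : is_dist s1 -> is_dist s2 -> NashMM u1 u2 s1 s2.
  apply: all_pure_nash_mixed => a b; apply: contrapT => nN.
  by apply: none; exists a, b.
case: C => [[_ _ [s1 [s2 [d1 d2]]]]|[_ _ [s1 [s2 [a [d1 d2 lt _]]]]]|
            [_ _ [s1 [s2 [b [d1 d2 lt _]]]]]]; first by apply; apply: all_nash.
  have [_ _ /(_ _ (is_dist_dirac a)) + _] := all_nash _ _ d1 d2.
  by rewrite leNgt lt.
have [_ _ _ /(_ _ (is_dist_dirac b))] := all_nash _ _ d1 d2.
by rewrite leNgt lt.
Qed.

Lemma card_gt1_neq1 (R : realType) (V : R -> Prop) : card_gt1 V -> ~ card_is1 V.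
Proof. by move=> [v [w [Vv Vw vw]]] [x Vx]; apply: vw; rewrite ((Vx v).1 Vv) ((Vx w).1 Vw). Qed.

Lemma card_gt1_neq0 (R : realType) (V : R -> Prop) : card_gt1 V -> ~ card_is0 V.
Proof. by move=> [v [w [Vv _ _]]] /(_ v). Qed.

Theorem mainTheorem18 (R : realType) (A1 A2 : finType)
    (hA1 : (0 < #|A1|)%N) (hA2 : (0 < #|A2|)%N)
    (u1 u2 : A1 -> A2 -> R) :
  (~ GLS_pp u1 u2 /\ GLS_mm u1 u2) <->
  [\/ [/\ card_is0 (V1pp u1 u2), card_is0 (V2pp u1 u2) & C_mm u1 u2],
      [/\ card_is1 (V1pp u1 u2), card_is1 (V2pp u1 u2) & C_mm u1 u2],
      [/\ card_gt1 (V1pp u1 u2), card_is1 (V2pp u1 u2), ~ C_pp u1 u2 & C_mm u1 u2]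
    | [/\ card_is1 (V1pp u1 u2), card_gt1 (V2pp u1 u2), ~ C_pp u1 u2 & C_mm u1 u2]].
Proof.
have /card_gt0P[a0 _] := hA1; have /card_gt0P[b0 _] := hA2.
rewrite (GLS_ppP a0 b0) (GLS_mmP a0 b0); split=> [[nC C]|].
  have [[a [b N]]|none] := pselect (exists a b, NashPP u1 u2 a b); last first.
    by apply: Or41; split=> // v [a [b [N _]]]; apply: none; exists a, b.
  have V1 : exists v, V1pp u1 u2 v by exists (u1 a b), a, b.
  have V2 : exists v, V2pp u1 u2 v by exists (u2 a b), a, b.
  have [c1|c1] := card_is1_or_gt1 V1; have [c2|c2] := card_is1_or_gt1 V2.
  - exact: Or42.
  - exact: Or44.
  - exact: Or43.
  (* Several values for both players and a pure profile that is not Nash form the first clause of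
     [C_pp], contrary to [nC]. *)
  - by case: nC; apply: Or31; split=> //; apply: C_mm_not_nash.
(* With no pure Nash value, or one for each player, [C_pp] fails: each of its clauses needs nonempty
   value sets and several values for some player. *)
move=> [[c1 _ C]|[c1 c2 C]|[_ _ nC C]|[_ _ nC C]]; split=> //.
- move=> [[/card_gt1_neq0//]|[/card_gt1_neq0//]|[[v Vv] _ _]].
  exact: (c1 v ((Vv v).2 erefl)).
- by move=> [[/card_gt1_neq1//]|[/card_gt1_neq1//]|[_ /card_gt1_neq1//]].
Qed.
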